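(* Let $\varepsilon>0$, $\Delta x>0$, $\Delta t>0$, and let $(\rho^n)_{n\ge 0}$, $(g^n)_{n\ge 0}$ be sequences, with $\rho^n=(\rho^n_i)_{i\in\mathbb{Z}}$ real and $g^n=(g^n_{i+\frac12})_{i\in\mathbb{Z}}$, $g^n_{i+\frac12}\in L^2([-1,1])$, satisfying for all $n\ge 0$, $i\in\mathbb{Z}$ the scheme (with no source term) $$\frac{\rho^{n+1}_i-\rho^n_i}{\Delta t}+\left[v\,\frac{g^{n+1}_{i+\frac12}-g^{n+1}_{i-\frac12}}{\Delta x}\right]=-\sigma_{A,i}\,\rho^{n+1}_i,$$ $$\frac{g^{n+1}_{i+\frac12}-g^n_{i+\frac12}}{\Delta t}+\frac{1}{\varepsilon\Delta x}(I-[\,\cdot\,])\Big(v^+(g^n_{i+\frac12}-g^n_{i-\frac12})+v^-(g^n_{i+\frac32}-g^n_{i+\frac12})\Big)=\frac{\sigma_{i+\frac12}}{\varepsilon^2}Lg^{n+1}_{i+\frac12}-\frac{1}{\varepsilon^2}v\,\frac{\rho^n_{i+1}-\rho^n_i}{\Delta x},$$ with initial data of finite energy $\sum_i(\rho^0_i)^2\Delta x+\varepsilon^2\sum_i[(g^0_{i+\frac12})^2]\Delta x<\infty$ and such that $[g^0_{i+\frac12}]=0$ for every $i$. If $\Delta t$ satisfies the CFL condition $$\Delta t\le \frac13\left(\tilde\sigma\,\Delta x^2+2\varepsilon\Delta x\right),\qquad \tilde\sigma=2s_m\sigma_m,$$ then for every $n\ge 0$ the energy estimate $$\sum_{i\in\mathbb{Z}}(\rho^n_i)^2\Delta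 x+\varepsilon^2\sum_{i\in\mathbb{Z}}\left[(g^n_{i+\frac12})^2\right]\Delta x\le \sum_{i\in\mathbb{Z}}(\rho^0_i)^2\Delta x+\varepsilon^2\sum_{i\in\mathbb{Z}}\left[(g^0_{i+\frac12})^2\right]\Delta x$$ holds (and hence the scheme is stable).
   Context: For a function $\phi$ of $v\in[-1,1]$, $[\phi]=\frac12\int_{-1}^1\phi(v)\,dv$ denotes its velocity average; $I$ is the identity, so $(I-[\,\cdot\,])\phi=\phi-[\phi]$. $v^{\pm}=\frac{v\pm|v|}{2}$. The collision operator acts on functions of $v$ only: $L\phi(v)=\int_{-1}^1 s(v,v')(\phi(v')-\phi(v))\,dv'$, where the measurable kernel $s$ satisfies $0<s_m\le s(v,v')\le s_M$ for all $v,v'\in[-1,1]$, $\int_{-1}^1 s(v,v')\,dv'=1$ for every $v$, and $s(v,v')=s(v',v)$. The cross sections $\sigma,\sigma_A:\mathbb{R}\to\mathbb{R}$ satisfy $0<\sigma_m\le\sigma(x)\le\sigma_M$ and $0\le\sigma_A(x)\le\sigma_{AM}$ for all $x$. The staggered grids are $x_i=i\Delta x$ and $x_{i+\frac12}=(i+\frac12)\Delta x$, $i\in\mathbb{Z}$, and $\sigma_{i+\frac12}=\sigma(x_{i+\frac12})$, $\sigma_{A,i}=\sigma_A(x_i)$. The scheme discretizes the micro-macro system $\partial_t\rho+\partial_x[vg]=-\sigma_A\rho$, $\partial_t g+\frac1\varepsilon(I-[\,\cdot\,])(v\partial_x g)=\frac{\sigma}{\varepsilon^2}Lg-\frac1{\varepsilon^2}v\partial_x\rho$,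 with $t_n=n\Delta t$, $\rho^n_i\approx\rho(t_n,x_i)$ and $g^n_{i+\frac12}(v)\approx g(t_n,x_{i+\frac12},v)$. *)

(* Defs.v *)
From HB Require Import structures.
From mathcomp Require Import all_boot all_order all_algebra.
From mathcomp Require Import all_classical all_reals all_analysis.

Set Implicit Arguments.
Unset Strict Implicit.
Unset Printing Implicit Defensive.

Import Order.TTheory GRing.Theory Num.Theory.
Import numFieldNormedType.Exports.

Local Open Scope classical_set_scope.
Local Open Scope ring_scope.

(* Functions of the velocity are represented by functions on the whole line;
   only their values on [-1, 1] are ever used. *)

(* [f] restricted to [-1, 1] represents an element of L^2([-1, 1]): its
   extension by 0 is a square-integrable function on the line. *)
Definition L2_velocity (R : realType) (f : R -> R) : Prop :=
  f \_ `[(-1 : R), 1] \in Lfun (@lebesgue_measure R) 2%:E.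

Definition vavg (R : realType) (f : R -> R) : R :=
  2^-1 * \int[@lebesgue_measure R]_(v in `[(-1 : R), 1]) f v.

Definition minus_vavg (R : realType) (f : R -> R) : R -> R :=
  fun v => f v - vavg f.

Definition vpos (R : realType) (v : R) : R := (v + `|v|) / 2.
Definition vneg (R : realType) (v : R) : R := (v - `|v|) / 2.

Definition collision (R : realType) (s : R -> R -> R) (f : R -> R) : R -> R :=
  fun v =>
    \int[@lebesgue_measure R]_(w in `[(-1 : R), 1]) (s v w * (f w - f v)).

Definition node (R : realType) (dx : R) (i : int) : R := i%:~R * dx.
Definition midpoint (R : realType) (dx : R) (i : int) : R :=
  (i%:~R + 2^-1) * dx.

(* In the following, [rho i] is the unknown at [node dx i], and [g i] is the
   unknown at [midpoint dx i], i.e., the one usually indexed by i + 1/2. *)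

Definition macro_scheme (R : realType) (dx dt : R) (sigmaA : R -> R)
    (rho rho' : int -> R) (g' : int -> R -> R) : Prop :=
  forall i : int,
    (rho' i - rho i) / dt
      + vavg (fun v => v * ((g' i v - g' (i - 1) v) / dx))
    = - sigmaA (node dx i) * rho' i.

(* The equation is an equality in L^2([-1, 1]), hence almost everywhere. *)
Definition micro_scheme (R : realType) (eps dx dt : R) (s : R -> R -> R)
    (sigma : R -> R) (rho : int -> R) (g g' : int -> R -> R) : Prop :=
  forall i : int, {ae @lebesgue_measure R, forall v : R, v \in `[(-1 : R), 1] ->
    (g' i v - g i v) / dt
      + 1 / (eps * dx) *
        minus_vavg (fun w => vpos w * (g i w - g (i - 1) w)
                           + vneg w * (g (i + 1) w - g i w)) v
    = sigma (midpoint dx i) / eps ^+ 2 * collision s (g' i) v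
      - 1 / eps ^+ 2 * (v * ((rho (i + 1) - rho i) / dx))}.

(* The sums over Z are sums of nonnegative terms in [0, +oo]. *)
Definition energy (R : realType) (eps dx : R)
    (rho : int -> R) (g : int -> R -> R) : \bar R :=
  (\esum_(i in [set: int]) (rho i ^+ 2 * dx)%:E
   + (eps ^+ 2)%:E
     * \esum_(i in [set: int]) (vavg (fun v => g i v ^+ 2) * dx)%:E)%E.

(* Main.v *)
(* Write D for the difference of g^{n+1} between neighbouring midpoints.
   Testing the macro equation with rho^{n+1} and the micro equation with
   eps^2 g^{n+1}, the two coupling terms leave, up to a discrete divergence,
   (rho^{n+1} - rho^n) [v D], absorbed by the time increment of rho at the cost
   of a multiple of [v D]^2 <= [|v| D^2] / 2.  The upwind transport yields
   eps [|v| D^2] / (2 dx) and a cross term with g^{n+1} - g^n, absorbed by the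
   time increment of g at the cost of another multiple of [|v| D^2].  The
   resulting sign-indefinite multiple of [|v| D^2] is compared with the
   collisional dissipation -2 s_m sigma_m [(g^{n+1})^2] through
   D^2 <= 2 (g_{i+1/2}^2 + g_{i-1/2}^2), and the CFL condition is what makes the
   collisions win.  All of this holds locally in i up to the difference of a
   flux dominated by the densities at the two times, which are summable because
   the micro equation determines g^{n+1} at i from its neighbours at time n. *)

Require Import Defs.
From HB Require Import structures.
From mathcomp Require Import all_boot all_order all_algebra.
From mathcomp Require Import all_classical all_reals all_analysis.
From mathcomp Require finmap.
From mathcomp Require Import measurable_realfun zify ring lra.

Import Order.TTheory GRing.Theory Num.Theory.
Import numFieldNormedType.Exports.

Local Open Scope classical_set_scope.
Local Open Scope ring_scope.

Set Implicit Arguments.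
Unset Strict Implicit.
Unset Printing Implicit Defensive.

(** * Velocity averages *)

Definition vintegrable (R : realType) (f : R -> R) : Prop :=
  (@lebesgue_measure R).-integrable `[(-1 : R), 1] (EFin \o f).

Section velocity_average.
Context {R : realType}.
Implicit Types f h : R -> R.
Local Notation mu := (@lebesgue_measure R).
Local Notation V := (`[(-1 : R), 1]).

Lemma ae_lebesgueS (P Q : R -> Prop) : (forall v, P v -> Q v) ->
  {ae mu, forall v, P v} -> {ae mu, forall v, Q v}.
Proof.
by move=> PQ [A [mA A0 PA]]; exists A; split => // v nQ; apply: PA => /PQ.
Qed.

Lemma vintegrableD f h : vintegrable f -> vintegrable h ->
  vintegrable (fun v => f v + h v).
Proof. move=> fi hi.
suff : mu.-integrable [set` V] ((EFin \o f) \+ (EFin \o h))%E by [].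
exact: integrableD. Qed.

Lemma vintegrableB f h : vintegrable f -> vintegrable h ->
  vintegrable (fun v => f v - h v).
Proof. move=> fi hi.
suff : mu.-integrable [set` V] ((EFin \o f) \- (EFin \o h))%E by [].
exact: integrableB. Qed.

Lemma vintegrableZ (c : R) f : vintegrable f -> vintegrable (fun v => c * f v).
Proof.
move=> fi; suff : mu.-integrable [set` V] (fun v => c%:E * (f v)%:E)%E by [].
exact: integrableZl. Qed.

Lemma vintegrable_bounded f (M : R) : measurable_fun [set` V] f ->
  (forall v, v \in V -> `|f v| <= M) -> vintegrable f.
Proof.
move=> mf fM; apply: measurable_bounded_integrable => //.
  by rewrite /= lebesgue_measure_itv/= lte_fin; case: ifP => //; rewrite ltry.
exists M; split; first exact: num_real.
by move=> x Mx v /= Vv; rewrite (le_trans (fM _ _) (ltW Mx)).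
Qed.

Lemma vintegrable_cst (c : R) : vintegrable (fun=> c).
Proof. by apply: (@vintegrable_bounded _ `|c|). Qed.

Lemma vintegrableMb f h (M : R) : vintegrable f -> measurable_fun [set` V] h ->
  (forall v, v \in V -> `|h v| <= M) -> vintegrable (fun v => h v * f v).
Proof.
move=> fi mh hM; have : mu.-integrable [set` V] ((EFin \o h) \* (EFin \o f))%E.
  apply: integrableMr => //.
  exists M; split; first exact: num_real.
  by move=> x Mx v /= Vv; rewrite (le_trans (hM _ _) (ltW Mx)).
by [].
Qed.

Lemma vavgD f h : vintegrable f -> vintegrable h ->
  vavg (fun v => f v + h v) = vavg f + vavg h.
Proof. by move=> fi hi; rewrite /vavg RintegralD// mulrDr. Qed.

Lemma vavgB f h : vintegrable f -> vintegrable h ->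
  vavg (fun v => f v - h v) = vavg f - vavg h.
Proof. by move=> fi hi; rewrite /vavg RintegralB// mulrBr. Qed.

Lemma vavgZ (c : R) f : vintegrable f -> vavg (fun v => c * f v) = c * vavg f.
Proof. by move=> fi; rewrite /vavg RintegralZl// mulrCA. Qed.

Lemma eq_vavg f h : {in V, f =1 h} -> vavg f = vavg h.
Proof.
move=> fh; congr (_ * _); apply: eq_Rintegral => v; rewrite inE => Vv.
exact: fh.
Qed.

Lemma eq_vintegrable f h : {in V, f =1 h} -> vintegrable f -> vintegrable h.
Proof.
move=> fh; apply: eq_integrable => // v; rewrite inE => Vv /=.
by rewrite fh.
Qed.

(** The hypothesis makes [f] agree almost everywhere with its absolute value, whose integral is
    nonnegative. *)
Lemma ae_vavg_ge0 f : measurable_fun [set` V] f ->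
  {ae mu, forall v, v \in V -> 0 <= f v} -> 0 <= vavg f.
Proof.
move=> mf f0; apply: mulr_ge0 => //.
have -> : \int[mu]_(v in [set` V]) f v = \int[mu]_(v in [set` V]) `|f v|.
  congr fine; apply: ae_eq_integral => //.
  - exact/measurable_EFinP.
  - by apply/measurable_EFinP; exact: measurableT_comp.
  - apply: ae_lebesgueS f0 => v /= f0 Vv; rewrite ger0_norm//.
    exact: f0.
by apply: Rintegral_ge0 => v _.
Qed.

Lemma ae_le_vavg f h : vintegrable f -> vintegrable h ->
  {ae mu, forall v, v \in V -> f v <= h v} -> vavg f <= vavg h.
Proof.
move=> fi hi fh; rewrite -subr_ge0 -vavgB//; apply: ae_vavg_ge0.
  by apply/measurable_EFinP; have /integrableP[] := vintegrableB hi fi.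
by apply: ae_lebesgueS fh => v /= + Vv; rewrite subr_ge0; apply.
Qed.

Lemma le_vavg f h : vintegrable f -> vintegrable h ->
  (forall v, v \in V -> f v <= h v) -> vavg f <= vavg h.
Proof.
by move=> fi hi fh; apply: ae_le_vavg => //; apply: aeW => v; exact: fh.
Qed.

Lemma ae_eq_vavg f h : vintegrable f -> vintegrable h ->
  {ae mu, forall v, v \in V -> f v = h v} -> vavg f = vavg h.
Proof.
move=> fi hi fh; apply/eqP; rewrite eq_le; apply/andP; split;
by apply: ae_le_vavg => //; apply: ae_lebesgueS fh => v /= + Vv => ->.
Qed.

Lemma vavg_ge0 f : (forall v, 0 <= f v) -> 0 <= vavg f.
Proof. by move=> f0; apply: mulr_ge0 => //; exact: Rintegral_ge0. Qed.

Lemma vintegral_cst (c : R) : \int[mu]_(v in [set` V]) c = 2 * c.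
Proof.
rewrite Rintegral_cst//= lebesgue_measure_itv/= lte_fin ifT; last by lra.
by rewrite -EFinD/= mulrC; congr (_ * _); lra.
Qed.

Lemma vavg_cst (c : R) : vavg (fun=> c) = c.
Proof. by rewrite /vavg vintegral_cst mulKf. Qed.

Lemma L2_vintegrableM f h : L2_velocity f -> L2_velocity h ->
  vintegrable (fun v => f v * h v).
Proof.
move=> f2 h2; have /Lfun1_integrable fh := Lfun2_mul_Lfun1 f2 h2.
have : mu.-integrable ([set` V] `&` setT) (EFin \o (fun v => f v * h v)).
  rewrite setIC; apply/integrable_restrict => //.
  rewrite (_ : _ \_ _ = (EFin \o (f \_ [set` V] \* h \_ [set` V]))) //.
  apply/funext => v; rewrite /= !patchE; case: ifPn => // _.
  by rewrite mul0r.
by rewrite setIT.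
Qed.

Lemma L2_measurable f : L2_velocity f -> measurable_fun [set` V] f.
Proof.
move=> /sub_Lfun_mfun; rewrite inE /= => mf.
by apply/(measurable_restrictT _ _).2 => //.
Qed.

(** On a bounded interval constants are integrable, and |f| <= 1 + f^2 gives the domination. *)
Lemma L2_vintegrable f : L2_velocity f -> vintegrable f.
Proof.
move=> f2.
have fd : vintegrable (fun v => 1 + f v * f v).
  by apply: vintegrableD; [exact: vintegrable_cst|exact: L2_vintegrableM].
apply: le_integrable fd => //.
  by apply/measurable_EFinP; exact: L2_measurable.
move=> v _ /=; rewrite lee_fin [leRHS]ger0_norm; last by nra.
by rewrite ler_norml; apply/andP; split; nra.
Qed.

End velocity_average.

(** * Moments of the velocity, upwind weights, and Cauchy-Schwarz for the weight |v| *)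

Section moments.
Context {R : realType}.
Implicit Types f h : R -> R.
Local Notation mu := (@lebesgue_measure R).
Local Notation V := (`[(-1 : R), 1]).

Lemma Rintegral_id (a b : R) : a < b ->
  \int[mu]_(v in `[a, b]) v = (b ^+ 2 - a ^+ 2) / 2.
Proof.
move=> ab; rewrite /Rintegral.
have dF (x : R) : is_derive x 1 (fun y : R => 2^-1 * (y * y)) x.
  apply: is_derive_eq => /=. rewrite /GRing.scale/= !mulr1. lra.
have cF : continuous (fun y : R => 2^-1 * (y * y)).
  by move=> x; apply: differentiable_continuous; apply/derivable1_diffP.
rewrite (@continuous_FTC2 _ _ (fun y => 2^-1 * (y * y)))//=.
- by rewrite !expr2; lra.
- by apply: continuous_in_subspaceT => x _; exact: cvg_id.
- split => [x _||] //.
  + exact/cvg_at_right_filter/cF.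
  + exact/cvg_at_left_filter/cF.
- by move=> x _; rewrite derive1E derive_val.
Qed.

Lemma velocity_le1 (v : R) : v \in V -> `|v| <= 1.
Proof. by rewrite in_itv/= ler_norml. Qed.

Lemma vintegrable_velocity : vintegrable (fun v : R => v).
Proof. by apply: (@vintegrable_bounded _ _ 1) => // v /velocity_le1. Qed.

Lemma measurable_vpos : measurable_fun [set` V] (@vpos R).
Proof.
apply: measurable_funM => //; exact: measurable_funD.
Qed.

Lemma measurable_vneg : measurable_fun [set` V] (@vneg R).
Proof.
apply: measurable_funM => //; exact: measurable_funB.
Qed.

Lemma vpos_le1 (v : R) : v \in V -> `|vpos v| <= 1.
Proof.
rewrite in_itv/= /vpos => /andP[v0 v1].
by rewrite ler_norml; case: (ger0P v) => ?; apply/andP; split; lra.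
Qed.

Lemma vneg_le1 (v : R) : v \in V -> `|vneg v| <= 1.
Proof.
rewrite in_itv/= /vneg => /andP[v0 v1].
by rewrite ler_norml; case: (ger0P v) => ?; apply/andP; split; lra.
Qed.

Lemma vintegrable_velocityM f : vintegrable f -> vintegrable (fun v => v * f v).
Proof. by move=> fi; apply: (@vintegrableMb _ _ _ 1) => // v /velocity_le1. Qed.

Lemma vintegrable_speedM f : vintegrable f ->
  vintegrable (fun v => `|v| * f v).
Proof.
move=> fi; apply: (@vintegrableMb _ _ _ 1) => //.
by move=> v /velocity_le1; rewrite normr_id.
Qed.

Lemma vintegrable_vposM f : vintegrable f ->
  vintegrable (fun v => vpos v * f v).
Proof.
move=> fi; apply: (@vintegrableMb _ _ _ 1) => //; first exact: measurable_vpos.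
exact: vpos_le1.
Qed.

Lemma vintegrable_vnegM f : vintegrable f ->
  vintegrable (fun v => vneg v * f v).
Proof.
move=> fi; apply: (@vintegrableMb _ _ _ 1) => //; first exact: measurable_vneg.
exact: vneg_le1.
Qed.

Lemma vavg_velocity : vavg (fun v : R => v) = 0.
Proof. by rewrite /vavg Rintegral_id; [lra|lra]. Qed.

Lemma vavg_speed : vavg (fun v : R => `|v|) = 2^-1.
Proof.
have i1 : mu.-integrable [set` V] (EFin \o (fun v => `|v|)).
  apply: (@vintegrable_bounded _ _ 1); first exact: normr_measurable.
  by move=> v /velocity_le1; rewrite normr_id.
have i2 : mu.-integrable `[(-1 : R), 0] (EFin \o (fun v => v)).
  apply: integrableS vintegrable_velocity => //.
  by apply: subset_itvl; rewrite bnd_simp.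
rewrite /vavg.
have := @Rintegral_itvB R _ _ _ 0 i1.
rewrite !bnd_simp => /(_ ltac:(lra) ltac:(lra)) /eqP.
rewrite subr_eq => /eqP ->.
rewrite Rintegral_itv_obnd_cbnd; last first.
  by apply: integrableS i1 => //; apply: subset_itvr; rewrite bnd_simp.
have -> : \int[mu]_(v in `[0, 1]) `|v| = \int[mu]_(v in `[0, 1]) v.
  apply: eq_Rintegral => v; rewrite inE /= in_itv/= => /andP[v0 _].
  exact: ger0_norm.
have -> : \int[mu]_(v in `[(-1), 0]) `|v| = - 1 * \int[mu]_(v in `[(-1), 0]) v.
  rewrite -RintegralZl//; apply: eq_Rintegral => v.
  by rewrite inE /= in_itv/= => /andP[_ v0]; rewrite ler0_norm// mulN1r.
by rewrite !Rintegral_id; lra.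
Qed.

(* Cauchy-Schwarz for the weight |v|, whose average is 1/2. *)
Lemma sqr_vavg_velocity f : vintegrable f -> vintegrable (fun v => f v * f v) ->
  vavg (fun v => v * f v) ^+ 2 <= 2^-1 * vavg (fun v => `|v| * (f v * f v)).
Proof.
move=> fi ffi; set B := vavg _; set A := vavg _.
(* For the weight |v|, [2 * B] is the coefficient of the projection of [f] on the sign of v, that
   sign having squared norm 1/2. The averaged square of the residual is A - 2 B^2. *)
have : 0 <= vavg (fun v => `|v| * (f v * f v) -
    (4 * B) * (v * f v) + (2 * B) ^+ 2 * `|v|).
  have : 0 <= vavg (fun v => `|v| * (f v - 2 * B * Num.sg v) ^+ 2).
    by apply: vavg_ge0 => v; rewrite mulr_ge0 ?sqr_ge0.
  rewrite (eq_vavg (h := fun v => `|v| * (f v * f v) -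
    (4 * B) * (v * f v) + (2 * B) ^+ 2 * `|v|)) // => v _.
  by case: sgrP => [->|v0|v0]; rewrite ?(gtr0_norm v0) ?(ltr0_norm v0) ?normr0;
    ring.
have i1 := vintegrable_speedM ffi.
have i2 := vintegrableZ (4 * B) (vintegrable_velocityM fi).
have i3 : vintegrable (fun v : R => `|v|).
  apply: eq_vintegrable (vintegrable_speedM (vintegrable_cst 1)) => v _ /=.
  by rewrite mulr1.
have i4 := vintegrableZ ((2 * B) ^+ 2) i3.
rewrite vavgD//; last exact: vintegrableB.
rewrite vavgB// !vavgZ//; last exact: vintegrable_velocityM.
rewrite vavg_speed -/A -/B; lra.
Qed.

End moments.

(** * The collision operator *)

Section collision_operator.
Context {R : realType}.
Implicit Types f h b : R -> R.
Implicit Types k s : R -> R -> R.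
Local Notation mu := (@lebesgue_measure R).
Local Notation V := (`[(-1 : R), 1]).

(** Fubini is applied on the whole line to extensions by 0; this brings the inner integrals back to
    [-1, 1]. *)
Lemma integral_patch_velocity h : vintegrable h ->
  (\int[mu]_v ((h \_ [set` V]) v)%:E)%E = (\int[mu]_(v in [set` V]) h v)%:E.
Proof.
move=> hi; rewrite /Rintegral fineK; last exact: integrable_fin_num.
rewrite [RHS]integral_mkcond; apply: eq_integral => v _.
by rewrite !patchE; case: ifP.
Qed.

Definition bounded_kernel k (M : R) : Prop :=
  measurable_fun ([set` V] `*` [set` V])
    (fun p : measurableTypeR R * measurableTypeR R => k p.1 p.2) /\
  (forall v w, v \in V -> w \in V -> `|k v w| <= M).

(** * Integral operators with a bounded kernel *)

Section kernel_integral.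
Variables (k : R -> R -> R) (M : R) (hk : bounded_kernel k M).

(** Extending the kernel by 0 off the square makes it measurable on the plane, so that its sections
    are measurable too. *)
Let kV (p : measurableTypeR R * measurableTypeR R) : R :=
  ((fun p => k p.1 p.2) \_ ([set` V] `*` [set` V])) p.

Let mkV : measurable_fun setT kV.
Proof.
apply/(measurable_restrictT _ _).1; last exact: hk.1.
exact: measurableX.
Qed.

Let kVE v w : kV (v, w) = if (v \in V) && (w \in V) then k v w else 0.
Proof.
rewrite /kV patchE; case: ifPn => [/set_mem[/= -> ->]//|/negP vw].
by case: ifP => // /andP[Vv Vw]; case: vw; exact/mem_set.
Qed.

Lemma measurable_kernel_section v : v \in V -> measurable_fun [set` V] (k v).
Proof.
move=> Vv; have := measurable_funTS (D := [set` V])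
  (measurable_fun_pair2 (v : measurableTypeR R) mkV).
apply/eq_measurable_fun => w; rewrite inE /= => Vw.
by rewrite kVE Vv Vw.
Qed.

Lemma measurable_kernel_cosection w : w \in V ->
  measurable_fun [set` V] (k^~ w).
Proof.
move=> Vw; have := measurable_funTS (D := [set` V])
  (measurable_fun_pair1 (w : measurableTypeR R) mkV).
apply/eq_measurable_fun => v; rewrite inE /= => Vv.
by rewrite kVE Vv Vw.
Qed.

Lemma vintegrable_kernel_section b v : vintegrable b -> v \in V ->
  vintegrable (fun w => k v w * b w).
Proof.
move=> bi Vv; apply: (@vintegrableMb _ _ _ M) => //.
  exact: measurable_kernel_section.
by move=> w; exact: hk.2.
Qed.

(** This is Fubini for k(v, w) b(w), which is dominated by M |b(w)| on the square. *)
Lemma kernel_integral b : vintegrable b ->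
  let K v := \int[mu]_(w in [set` V]) (k v w * b w) in
  vintegrable K /\
  \int[mu]_(v in [set` V]) K v =
    \int[mu]_(w in [set` V]) (b w * \int[mu]_(v in [set` V]) k v w).
Proof.
move=> bi K.
pose F (p : measurableTypeR R * measurableTypeR R) : R :=
  kV p * (b \_ [set` V]) p.2.
have inV v : (v \in [set` V]) = (v \in V).
  by apply/idP/idP => [/set_mem|/mem_set].
have mb : measurable_fun setT (b \_ [set` V]).
  apply/(measurable_restrictT _ _).1 => //.
  by apply/measurable_EFinP; case/integrableP: bi.
have mF : measurable_fun setT (EFin \o F).
  apply/measurable_EFinP; apply: measurable_funM => //.
  exact: (measurableT_comp mb measurable_snd).
have FE v w : F (v, w) = ((fun v => ((fun w => k v w * b w) \_ [set` V]) w)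
                          \_ [set` V]) v.
  rewrite /F kVE !patchE/= !inV.
  by case: (v \in V); case: (w \in V); rewrite /= ?mul0r ?mulr0.
have FK v : (\int[mu]_w (F (v, w))%:E)%E = ((K \_ [set` V]) v)%:E.
  under eq_integral do rewrite FE patchE.
  rewrite patchE; case: ifPn => [/set_mem /= Vv|_]; last by rewrite integral0.
  by rewrite integral_patch_velocity//; exact: vintegrable_kernel_section.
have iF : (mu \x mu)%E.-integrable setT (EFin \o F).
  apply/integrable12ltyP => //.
  (* For v in [-1, 1] the integral of |F(v, w)| in w is at most [B], and it is 0 for other v; hence
     the iterated integral is finite. *)
  pose B := M * \int[mu]_(w in [set` V]) `|b w|.
  have iB : vintegrable (fun=> B) := vintegrable_cst B.
  apply: (@le_lt_trans _ _
    (\int[mu]_v (((fun=> B) \_ [set` V]) v)%:E)%E); last first.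
    by rewrite integral_patch_velocity// ltry.
  have FB v : (\int[mu]_w `|(F (v, w))%:E| <=
      (((fun=> B) \_ [set` V]) v)%:E)%E.
    rewrite [leRHS](_ : _ = (if v \in V then B else 0)%:E); last first.
      by rewrite patchE inV.
    case: ifPn => Vv; last first.
      rewrite integral0_eq// => w _.
      by rewrite FE patchE inV (negbTE Vv) /= normr0.
    have -> : (\int[mu]_w `|(F (v, w))%:E|)%E =
      (\int[mu]_w (((fun w => `|k v w * b w|) \_ [set` V]) w)%:E)%E.
      apply: eq_integral => w _; rewrite FE !patchE !inV Vv.
      by case: ifP => // _; rewrite /= normr0.
    have ib := integrable_norm bi.
    have ikb := integrable_norm (vintegrable_kernel_section bi Vv).
    rewrite integral_patch_velocity// lee_fin /B -RintegralZl//.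
    apply: le_Rintegral => //; first exact: vintegrableZ.
    by move=> w Vw; rewrite normrM ler_wpM2r// hk.2.
  apply: ge0_le_integral => //.
  - by move=> v _; exact: integral_ge0.
  - have maF : measurable_fun setT (abse \o (EFin \o F)).
      exact: measurableT_comp.
    have aF0 p : (0 <= (abse \o (EFin \o F)) p)%E by exact: abse_ge0.
    exact: (measurable_fun_fubini_tonelli_F _ maF aF0).
  - apply/measurable_EFinP; apply/(measurable_restrictT _ _).1 => //.
  - by move=> v _; exact: FB.
have intF w : w \in V ->
    (\int[mu]_v (F (v, w))%:E)%E =
    (b w * \int[mu]_(v in [set` V]) k v w)%:E.
  move=> Vw; have ik : vintegrable (k^~ w).
    apply: (@vintegrable_bounded _ _ M).
      exact: measurable_kernel_cosection.
    by move=> v Vv; exact: hk.2.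
  rewrite -RintegralZl// -integral_patch_velocity; last exact: vintegrableZ.
  apply: eq_integral => v _; rewrite FE !patchE !inV Vw.
  by case: ifP => // _; rewrite mulrC.
split.
  have := integrable_fubini_F iF.
  have -> : fubini_F mu (EFin \o F) = EFin \o (K \_ [set` V]).
    by apply/funext => v; exact: FK.
  move=> iK; have : mu.-integrable ([set` V] `&` setT) (EFin \o K).
    rewrite setIC; apply/integrable_restrict => //.
    by apply: eq_integrable iK => // v _; rewrite /= !patchE; case: ifP.
  by rewrite setIT.
rewrite Rintegral_mkcond [RHS]Rintegral_mkcond /Rintegral; congr fine.
transitivity (\int[mu]_v \int[mu]_w (EFin \o F) (v, w))%E.
  by apply: eq_integral => v _; rewrite FK patchE.
rewrite (Fubini iF); apply: eq_integral => w _; rewrite patchE inV.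
case: ifPn => Vw; first exact: intF.
rewrite integral0_eq// => v _.
by rewrite /= FE !patchE !inV (negbTE Vw); case: ifP.
Qed.

End kernel_integral.

(** * Mass conservation and coercivity of the collision operator *)

Section admissible_kernel.
Context (s : R -> R -> R) (s_m s_M : R).
Hypothesis s_meas : measurable_fun ([set` V] `*` [set` V])
  (fun p : measurableTypeR R * measurableTypeR R => s p.1 p.2).
Hypothesis s_m_gt0 : 0 < s_m.
Hypothesis s_bounds :
  forall v w, v \in V -> w \in V -> s_m <= s v w <= s_M.
Hypothesis s_int :
  forall v, v \in V -> \int[mu]_(w in [set` V]) s v w = 1.
Hypothesis s_sym : forall v w, v \in V -> w \in V -> s v w = s w v.

Let bs : bounded_kernel s s_M.
Proof.
split=> // v w Vv Vw; have /andP[h1 h2] := s_bounds Vv Vw.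
by rewrite ger0_norm// (le_trans (ltW s_m_gt0)).
Qed.

Let bs_m : bounded_kernel (fun v w => s v w - s_m) s_M.
Proof.
split=> [|v w Vv Vw]; first exact: measurable_funB.
have /andP[h1 h2] := s_bounds Vv Vw.
rewrite ger0_norm ?subr_ge0//.
by rewrite (le_trans _ h2)// gerBl ltW.
Qed.

Let K f v := \int[mu]_(w in [set` V]) (s v w * f w).

Let section_int v : v \in V -> vintegrable (s v).
Proof.
move=> Vv; apply: (@vintegrable_bounded _ _ s_M).
  exact: (measurable_kernel_section bs Vv).
by move=> w; exact: bs.2.
Qed.

Let cosection_int w : w \in V -> \int[mu]_(v in [set` V]) s v w = 1.
Proof.
move=> Vw.
transitivity (\int[mu]_(v in [set` V]) s w v); last exact: s_int.
apply: eq_Rintegral => v.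
by rewrite inE /= => Vv; exact: s_sym.
Qed.

(** The unit mass of [s v] reduces the loss term to f(v), which leaves an integral operator minus
    the identity. *)
Let collisionE f v : vintegrable f -> v \in V ->
  collision s f v = K f v - f v.
Proof.
move=> fi Vv; rewrite /collision.
under eq_Rintegral do rewrite mulrBr (mulrC _ (f v)).
rewrite RintegralB//; last 2 first.
- exact: (vintegrable_kernel_section bs fi Vv).
- by apply: vintegrableZ; exact: section_int.
by rewrite RintegralZl ?s_int ?mulr1//; exact: section_int.
Qed.

Lemma vintegrable_collision f : vintegrable f -> vintegrable (collision s f).
Proof.
move=> fi; apply: (@eq_vintegrable _ (fun v => K f v - f v)).
  by move=> v Vv; rewrite collisionE.
by apply: vintegrableB => //; have [] := kernel_integral bs fi.
Qed.

(** By symmetry the kernel has unit mass in its first variable as well, so after exchanging the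
    integrals the gain term has the same average as [f]. *)
Lemma vavg_collision f : vintegrable f -> vavg (collision s f) = 0.
Proof.
move=> fi; have [Ki Ks] := kernel_integral bs fi.
rewrite (eq_vavg (h := fun v => K f v - f v)) => [|v Vv]; last first.
  exact: collisionE.
rewrite vavgB// /vavg Ks -mulrBr; apply/eqP; rewrite mulf_eq0; apply/orP; right.
rewrite subr_eq0; apply/eqP; apply: eq_Rintegral => w; rewrite inE /= => Vw.
by rewrite cosection_int ?mulr1.
Qed.

(** The gain term [K f] is bounded, by [s_M] times the integral of |f|, so its product with [f] is
    integrable; the rest is f^2. *)
Lemma vintegrableM_collision f : L2_velocity f ->
  vintegrable (fun v => f v * collision s f v).
Proof.
move=> f2; have fi := L2_vintegrable f2.
have [Ki _] := kernel_integral bs fi.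
apply: (@eq_vintegrable _ (fun v => K f v * f v - f v * f v)).
  by move=> v Vv; rewrite collisionE//; ring.
apply: vintegrableB; last exact: L2_vintegrableM.
apply: (@vintegrableMb _ _ _ (s_M * \int[mu]_(w in [set` V]) `|f w|)) => //.
  by apply/measurable_EFinP; case/integrableP: Ki.
move=> v Vv; have ki := vintegrable_kernel_section bs fi Vv.
rewrite (le_trans (le_normr_Rintegral _ ki))// -RintegralZl//; last first.
  exact: (integrable_norm fi).
apply: le_Rintegral => //; first exact: (integrable_norm ki).
  exact: (vintegrableZ s_M (integrable_norm fi)).
by move=> w Vw; rewrite normrM ler_wpM2r// bs.2.
Qed.

(* With k = s - s_m >= 0, the integral of k(v, w) f(v) f(w) is at most that of
   k(v, w) (f(v)^2 + f(w)^2) / 2, and both marginals of k are 1 - 2 s_m. *)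
Lemma collision_coercive f : L2_velocity f -> vavg f = 0 ->
  vavg (fun v => f v * collision s f v)
  <= - (2 * s_m) * vavg (fun v => f v * f v).
Proof.
move=> f2 f0; have fi := L2_vintegrable f2.
have ffi := L2_vintegrableM f2 f2.
have fint0 : \int[mu]_(w in [set` V]) f w = 0.
  by move: f0 => /eqP; rewrite mulf_eq0 invr_eq0 pnatr_eq0 => /orP[//|/eqP].
pose k v w := s v w - s_m.
pose K2 v := \int[mu]_(w in [set` V]) (k v w * (f w * f w)).
have [K2i K2s] : vintegrable K2 /\ \int[mu]_(v in [set` V]) K2 v = _ :=
  kernel_integral bs_m ffi.
have k_int v : v \in V -> \int[mu]_(w in [set` V]) k v w = 1 - 2 * s_m.
  move=> Vv; rewrite RintegralB//; last exact: vintegrable_cst.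
    by rewrite s_int// vintegral_cst.
  exact: section_int.
have k_coint w : w \in V -> \int[mu]_(v in [set` V]) k v w = 1 - 2 * s_m.
  move=> Vw; rewrite -(k_int _ Vw); apply: eq_Rintegral => v.
  by rewrite inE /= => Vv; rewrite /k s_sym.
have K2avg : vavg K2 = (1 - 2 * s_m) * vavg (fun v => f v * f v).
  rewrite -vavgZ// /vavg K2s; congr (_ * _); apply: eq_Rintegral => w.
  by rewrite inE /= => Vw; rewrite k_coint// mulrC.
(* [c] collects the coefficients of f(v)^2 in the pointwise bound: half the mass of [k] from the
   product inequality, and -1 from the loss term. The average of [K2] / 2 adds another half mass,
   for a total of - 2 s_m. *)
pose c := 2^-1 * (1 - 2 * s_m) - 1.
have -> : - (2 * s_m) * vavg (fun v => f v * f v) =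
          vavg (fun v => c * (f v * f v) + 2^-1 * K2 v).
  rewrite vavgD ?vavgZ ?K2avg//; try exact: vintegrableZ.
  by rewrite /c; field.
apply: le_vavg; first exact: vintegrableM_collision.
  by apply: vintegrableD; exact: vintegrableZ.
move=> v Vv; rewrite collisionE//.
have kfi := vintegrable_kernel_section bs_m fi Vv.
have kffi := vintegrable_kernel_section bs_m ffi Vv.
have ki : vintegrable (k v).
  by apply: vintegrableB; [exact: section_int|exact: vintegrable_cst].
(* The zero average of [f] enters here: removing the constant [s_m] from the kernel leaves its
   integral against [f] unchanged. *)
have Kk : K f v = \int[mu]_(w in [set` V]) (k v w * f w).
  under [RHS]eq_Rintegral do rewrite /k mulrBl.
  rewrite RintegralB//; last exact: vintegrableZ.
    by rewrite RintegralZl// fint0 mulr0 subr0.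
  exact: (vintegrable_kernel_section bs fi Vv).
have : f v * K f v <= 2^-1 * (f v * f v) * (1 - 2 * s_m) + 2^-1 * K2 v.
  rewrite Kk -(k_int _ Vv) -!RintegralZl//.
  rewrite -RintegralD//; try exact: vintegrableZ.
  apply: le_Rintegral => //; first exact: vintegrableZ.
    by apply: vintegrableD; exact: vintegrableZ.
  move=> w /= Vw; have kp : 0 <= k v w.
    by have /andP[h _] := s_bounds Vv Vw; rewrite subr_ge0.
  rewrite -subr_ge0 (_ : _ - _ = k v w * (2^-1 * (f v - f w) ^+ 2)).
    by rewrite mulr_ge0// mulr_ge0// sqr_ge0.
  by field.
by rewrite /c; lra.
Qed.

End admissible_kernel.
End collision_operator.

(** * Telescoping over the integers *)

Section sums_over_integers.
Context {R : realType}.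
Implicit Types a b : int -> R.

Lemma le_sum_esum (r : seq int) a : uniq r ->
  ((\sum_(i <- r) a i)%:E <= \esum_(i in [set: int]) (a i)%:E)%E.
Proof.
move=> ur; apply: esum_ge; exists [set` r].
  by split=> //; exact: finite_seq.
by rewrite -fsbig_seq// sumEFin.
Qed.

Lemma esum_le_sum (y : \bar R) a :
  (forall r : seq int, uniq r -> ((\sum_(i <- r) a i)%:E <= y)%E) ->
  (\esum_(i in [set: int]) (a i)%:E <= y)%E.
Proof.
move=> ay; rewrite ge_ereal_sup => //= _ [X [finX XI]] <-.
by rewrite fsbig_finite//= sumEFin; apply: ay; exact: finmap.fset_uniq.
Qed.

(** One inequality suffices: the reverse one is the same statement for c^-1 and the family c a. *)
Lemma esumZl (c : R) a : 0 < c ->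
  (\esum_(i in [set: int]) (c * a i)%:E =
   c%:E * \esum_(i in [set: int]) (a i)%:E)%E.
Proof.
have le1 d b : 0 < d -> (\esum_(i in [set: int]) (d * b i)%:E <=
    d%:E * \esum_(i in [set: int]) (b i)%:E)%E.
  move=> d0; apply: esum_le_sum => r ur.
  by rewrite -mulr_sumr EFinM lee_wpmul2l ?le_sum_esum// lee_fin ltW.
move=> c0; apply/eqP; rewrite eq_le le1//=.
rewrite -lee_pdivlMl//.
have := le1 c^-1 (fun i => c * a i); rewrite invr_gt0 => /(_ c0).
by apply: le_trans; apply: le_esum => i _; rewrite mulKf// gt_eqF.
Qed.

Definition fin_esum a : Prop := (\esum_(i in [set: int]) (a i)%:E < +oo)%E.

Lemma fin_esum_le a b : (forall i, a i <= b i) -> fin_esum b -> fin_esum a.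
Proof. by move=> ab; apply: le_lt_trans; apply: le_esum => i _; exact: ab. Qed.

Lemma fin_esumD a b : (forall i, 0 <= a i) -> (forall i, 0 <= b i) ->
  fin_esum a -> fin_esum b -> fin_esum (fun i => a i + b i).
Proof.
move=> a0 b0 fa fb; rewrite /fin_esum.
under eq_esum do rewrite EFinD.
by rewrite esumD ?lte_add_pinfty// => i _; rewrite lee_fin.
Qed.

Lemma fin_esumZ (c : R) a : 0 < c -> (forall i, 0 <= a i) ->
  fin_esum a -> fin_esum (fun i => c * a i).
Proof.
move=> c0 a0 fa; rewrite /fin_esum esumZl// lte_mul_pinfty// ?lee_fin ?ltW//.
Qed.

Lemma fin_esum_shift (j : int) a : fin_esum a -> fin_esum (fun i => a (i + j)).
Proof.
rewrite /fin_esum (reindex_esum [set: int] [set: int] (fun i => i + j))//.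
split=> // [i k _ _ /addIr //|i _].
by exists (i - j) => //; rewrite subrK.
Qed.

(** These are the integers of [-N, N), in increasing order so that consecutive differences
    telescope. *)
Let window (N : nat) : seq int := [seq (Posz k - Posz N) | k <- iota 0 (N + N)].

Let uniq_window N : uniq (window N).
Proof. by rewrite map_inj_uniq ?iota_uniq// => i k /addIr []. Qed.

Let sum_le_window (r : seq int) a : uniq r -> (forall i, 0 <= a i) ->
  exists N0, forall N, (N0 <= N)%N ->
    \sum_(i <- r) a i <= \sum_(i <- window N) a i.
Proof.
(* The successor is there because the window leaves out its right end N. *)
move=> ur a0; exists (\max_(i <- r) `|i|%N).+1 => N N0N.
have sub (i : int) : i \in r -> i \in window N.
  move=> ir; have ile : (`|i| <= \max_(j <- r) `|j|)%N.
    by rewrite (big_rem i)//= leq_maxl.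
  by apply/mapP; exists `|(i + Posz N)%R|%N; [rewrite mem_iota; lia|lia].
rewrite (perm_big [seq i <- window N | i \in r]) /=; last first.
  apply: uniq_perm => //; first exact: filter_uniq.
  by move=> i; rewrite mem_filter; case: (boolP (i \in r)) => // /sub ->.
rewrite big_filter big_mkcond; apply: ler_sum => i _.
by case: ifP.
Qed.

Let window_telescope N (f : int -> R) :
  \sum_(i <- window N) (f (i + 1) - f i) = f (Posz N) - f (- Posz N).
Proof.
rewrite big_map -[X in iota _ X](subn0 (N + N)).
rewrite -[LHS]/(\sum_(0 <= k < N + N) _).
rewrite (eq_bigr (fun k : nat => f (Posz k.+1 - Posz N) - f (Posz k - Posz N))).
  rewrite (telescope_sumr (fun k : nat => f (Posz k - Posz N)))//.
  by congr (f _ - f _); lia.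
by move=> k _; congr (f _ - f _); lia.
Qed.

(** Otherwise a(N) + a(-N) >= d for all N >= N0, and M such pairs would add up to at least M d,
    whereas each of the two half-lines contributes at most the finite total. *)
Let vanishing_boundary a (N0 : nat) (d : R) : 0 < d -> (forall i, 0 <= a i) ->
  fin_esum a ->
  exists2 N, (N0 <= N)%N & a (Posz N) + a (- Posz N) < d.
Proof.
move=> d0 a0 fa; apply: contrapT => nex.
have ad N : (N0 <= N)%N -> d <= a (Posz N) + a (- Posz N).
  by move=> N0N; rewrite leNgt; apply/negP => Nd; apply: nex; exists N.
set T := (\esum_(i in [set: int]) (a i)%:E)%E.
have Tf : T \is a fin_num.
  by rewrite ge0_fin_numE//; apply: esum_ge0 => i _; rewrite lee_fin.
have bound M : M%:R * d <= fine T + fine T.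
  have sum1 : \sum_(k <- iota N0 M) a (Posz k) <= fine T.
    rewrite -lee_fin fineK// -(big_map Posz xpredT a) le_sum_esum//.
    by rewrite map_inj_uniq ?iota_uniq// => i k [].
  have sum2 : \sum_(k <- iota N0 M) a (- Posz k) <= fine T.
    rewrite -lee_fin fineK// -(big_map (fun k => - Posz k) xpredT a).
    by rewrite le_sum_esum// map_inj_uniq ?iota_uniq// => i k /oppr_inj [].
  apply: le_trans (lerD sum1 sum2); rewrite -big_split/=.
  have -> : M%:R * d = \sum_(k <- iota N0 M) d.
    by rewrite big_const_seq count_predT size_iota iter_addr_0 mulr_natl.
  rewrite !big_seq; apply: ler_sum => k.
  by rewrite mem_iota => /andP[N0k _]; exact: ad.
have := bound (Num.truncn ((fine T + fine T) / d)).+1.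
rewrite leNgt -ltr_pdivrMr// => /negP; apply.
have : 0 <= (fine T + fine T) / d.
  by rewrite divr_ge0 ?addr_ge0 ?fine_ge0 ?esum_ge0// ?ltW// => i _;
    rewrite lee_fin.
by move=> /truncn_itv /andP[].
Qed.

(* The boundary terms of the telescoped sum over [-N, N) are dominated by
   a summable family, hence arbitrarily small along a sequence of N. *)
Lemma esum_le_telescope (e e' F a : int -> R) :
  (forall i, 0 <= e i) -> (forall i, 0 <= e' i) ->
  (forall i, `|F i| <= a i) -> fin_esum a ->
  (forall i, e' i <= e i + (F (i + 1) - F i)) ->
  (\esum_(i in [set: int]) (e' i)%:E <= \esum_(i in [set: int]) (e i)%:E)%E.
Proof.
move=> e0 e'0 Fa fa ee'; apply: esum_le_sum => r ur.
apply/lee_addgt0Pr => d d0.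
have a0 i : 0 <= a i by exact: le_trans (Fa i).
have [N0 hN0] := sum_le_window ur e'0.
have [N N0N aN] := vanishing_boundary N0 d0 a0 fa.
apply: (@le_trans _ _ (\sum_(i <- window N) e i + d)%:E); last first.
  by rewrite EFinD leeD2r// le_sum_esum.
rewrite lee_fin (le_trans (hN0 _ N0N))//.
apply: (@le_trans _ _ (\sum_(i <- window N) (e i + (F (i + 1) - F i)))).
  by apply: ler_sum => i _; exact: ee'.
rewrite big_split/= lerD2l window_telescope.
have := Fa (Posz N); have := Fa (- Posz N).
by rewrite !ler_norml => /andP[? ?] /andP[? ?]; lra.
Qed.

End sums_over_integers.

(** * Pointwise and scalar inequalities of the energy estimate *)

Section pointwise_estimates.
Context {R : realType} (eps dx dt : R).
Hypotheses (eps_gt0 : 0 < eps) (dx_gt0 : 0 < dx) (dt_gt0 : 0 < dt).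

Definition upwind (v x0 x1 x2 : R) : R :=
  vpos v * (x1 - x0) + vneg v * (x2 - x1).

(** The first term is the numerical viscosity of upwinding; the second is what absorbing the cross
    term with the time increment of g costs. *)
Definition dissipation_rate : R := eps / (2 * dx) - dt / (2 * dx ^+ 2).

(** Here x and y are the values at the old and new times at two neighbouring midpoints. With d = y -
    x, the terms in y^2 / 2 and in d times the neighbouring y come from summation by parts. The
    squares (y1 - y0)^2 move a dissipation term to the next cell, so that both signs of v end up
    with the same difference. *)
Definition transport_flux (v x0 x1 y0 y1 : R) : R :=
  vpos v * (eps / dx * (2^-1 * (y0 * y0) - (y1 * y0 - y1 * x0))
            - dt / (2 * dx ^+ 2) * (y1 * y1 - 2 * (y1 * y0) + y0 * y0))
  + vneg v * (eps / dx * (2^-1 * (y1 * y1) - (y0 * y1 - y0 * x1)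
                          - 2^-1 * (y1 * y1 - 2 * (y1 * y0) + y0 * y0))).

Lemma vpos_ge0E (v : R) : 0 <= v -> vpos v = v.
Proof. by move=> v0; rewrite /vpos ger0_norm//; lra. Qed.

Lemma vneg_ge0E (v : R) : 0 <= v -> vneg v = 0.
Proof. by move=> v0; rewrite /vneg ger0_norm//; lra. Qed.

Lemma vpos_le0E (v : R) : v <= 0 -> vpos v = 0.
Proof. by move=> v0; rewrite /vpos ler0_norm//; lra. Qed.

Lemma vneg_le0E (v : R) : v <= 0 -> vneg v = v.
Proof. by move=> v0; rewrite /vneg ler0_norm//; lra. Qed.

(* Summation by parts of g' times the upwind differences of g = g' - d, where
   d is absorbed by the time increment. *)
Lemma upwind_pointwise (v x0 x1 x2 y0 y1 y2 : R) : `|v| <= 1 ->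
  eps ^+ 2 / (2 * dt) * (y1 * y1 - x1 * x1)
  + dissipation_rate * (`|v| * ((y1 - y0) * (y1 - y0)))
  + (transport_flux v x1 x2 y1 y2 - transport_flux v x0 x1 y0 y1)
  <= eps ^+ 2 / dt * (y1 * y1 - x1 * y1)
     + eps / dx * (upwind v x0 x1 x2 * y1).
Proof.
rewrite /transport_flux /upwind /dissipation_rate => v1.
have dtx : 0 <= dt / (2 * dx ^+ 2).
  by rewrite divr_ge0 ?ltW// mulr_gt0// exprn_gt0.
have dt2 : 0 <= (2 * dt)^-1 by rewrite invr_ge0 mulr_ge0// ltW.
rewrite -subr_ge0; case: (leP 0 v) v1 => [v0|/ltW v0].
  rewrite vpos_ge0E// vneg_ge0E// ger0_norm// => v1.
  (* The gap between the two sides is the square that absorbs the time increment, plus the loss v -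
     v^2 >= 0 from replacing v^2 by |v| in front of the squared difference. *)
  rewrite [X in 0 <= X](_ : _ = (2 * dt)^-1 *
      (eps * (y1 - x1) + dt * v * (y2 - y1) / dx) ^+ 2
      + dt / (2 * dx ^+ 2) * (v * (1 - v) * (y2 - y1) ^+ 2)); last first.
    by field; rewrite !gt_eqF.
  apply: addr_ge0; first by rewrite mulr_ge0 ?sqr_ge0.
  apply: mulr_ge0 => //; apply: mulr_ge0; last exact: sqr_ge0.
  by rewrite mulr_ge0// subr_ge0.
rewrite vpos_le0E// vneg_le0E// ler0_norm// => v1.
rewrite [X in 0 <= X](_ : _ = (2 * dt)^-1 *
    (eps * (y1 - x1) + dt * v * (y1 - y0) / dx) ^+ 2
    + dt / (2 * dx ^+ 2) * (- v * (1 + v) * (y1 - y0) ^+ 2)); last first.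
  by field; rewrite !gt_eqF.
apply: addr_ge0; first by rewrite mulr_ge0 ?sqr_ge0.
apply: mulr_ge0 => //; apply: mulr_ge0; last exact: sqr_ge0.
by rewrite mulr_ge0 ?oppr_ge0//; lra.
Qed.

(** A crude constant is enough, since it serves only to dominate the boundary terms by a summable
    family. *)
Definition flux_bound : R := 4 * (eps / dx) + dt / dx ^+ 2.

Lemma flux_bound_gt0 : 0 < flux_bound.
Proof.
by apply: addr_gt0; [apply: mulr_gt0|]; rewrite ?divr_gt0// exprn_gt0.
Qed.

Lemma norm_transport_flux (v x0 x1 y0 y1 : R) : `|v| <= 1 ->
  `|transport_flux v x0 x1 y0 y1|
  <= flux_bound * (x0 * x0 + x1 * x1 + y0 * y0 + y1 * y1).
Proof.
move=> v1; rewrite /transport_flux /flux_bound.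
set q := (_ + _ + _ + _).
have ed : 0 < eps / dx by rewrite divr_gt0.
have dd : dt / (2 * dx ^+ 2) = 2^-1 * (dt / dx ^+ 2).
  by field; rewrite gt_eqF.
rewrite dd; have dq : 0 < dt / dx ^+ 2 by rewrite divr_gt0 ?exprn_gt0.
move: ed dq; set p := eps / dx; set m := dt / dx ^+ 2 => p0 m0.
have bound a b c : `|a| <= c -> `|b| <= 1 -> `|b * a| <= c.
  by move=> ac b1; rewrite normrM (le_trans _ ac)// ler_piMl.
have s1 := sqr_ge0 (y1 + y0); have s2 := sqr_ge0 (y1 - y0).
have s3 := sqr_ge0 (y1 + x0); have s4 := sqr_ge0 (y1 - x0).
have s5 := sqr_ge0 (y0 + x1); have s6 := sqr_ge0 (y0 - x1).
have t0 := sqr_ge0 x0; have t1 := sqr_ge0 x1.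
have t2 := sqr_ge0 y0; have t3 := sqr_ge0 y1.
have A1 : `|2^-1 * (y0 * y0) - (y1 * y0 - y1 * x0)| <= 2 * q.
  by rewrite ler_norml /q; apply/andP; split; lra.
have A2 : `|y1 * y1 - 2 * (y1 * y0) + y0 * y0| <= 2 * q.
  by rewrite ler_norml /q; apply/andP; split; lra.
have A3 : `|2^-1 * (y1 * y1) - (y0 * y1 - y0 * x1) -
            2^-1 * (y1 * y1 - 2 * (y1 * y0) + y0 * y0)| <= 2 * q.
  by rewrite ler_norml /q; apply/andP; split; lra.
have q0 : 0 <= q by rewrite /q; lra.
have B a c : 0 < c -> `|a| <= 2 * q -> `|c * a| <= 2 * (c * q).
  by move=> c0 aq; rewrite normrM gtr0_norm// mulrCA ler_pM2l.
have C1 := B _ _ p0 A1.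
have C2 := B _ (2^-1 * m) ltac:(lra) A2.
have C3 := B _ _ p0 A3.
have mq : 0 <= m * q by rewrite mulr_ge0// ltW.
have pq : 0 <= p * q by rewrite mulr_ge0// ltW.
case: (leP 0 v) => [v0|/ltW v0].
  rewrite vpos_ge0E// vneg_ge0E// mul0r addr0; apply: bound => //.
  by rewrite (le_trans (ler_normB _ _))// (le_trans (lerD C1 C2))//; lra.
rewrite vpos_le0E// vneg_le0E// mul0r add0r; apply: bound => //.
by rewrite (le_trans C3)//; lra.
Qed.

(** The factor 3 comes from (a + b + c)^2 <= 3 (a^2 + b^2 + c^2) for the three explicit terms of the
    micro update; the factor 6 from a further 2 for squares of differences. *)
Definition update_bound : R :=
  3 * eps ^+ 4 + 6 * (dt * eps / dx) ^+ 2 + 6 * (dt / dx) ^+ 2.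

Lemma update_bound_gt0 : 0 < update_bound.
Proof.
apply: ltr_wpDr; first by rewrite mulr_ge0// sqr_ge0.
apply: ltr_wpDr; first by rewrite mulr_ge0// sqr_ge0.
by rewrite mulr_gt0// exprn_gt0.
Qed.

(** Young's inequality for the explicit part of the micro update tested with the new value [y]. Only
    half of eps^2 y^2 is spent, so that it can be absorbed on the other side. *)
Lemma update_pointwise (v x0 x1 x2 y r0 r1 : R) : `|v| <= 1 ->
  (eps ^+ 2 * x1 - dt * eps / dx * upwind v x0 x1 x2
   - dt * ((r1 - r0) / dx) * v) * y
  <= eps ^+ 2 / 2 * (y * y)
     + update_bound / (2 * eps ^+ 2)
       * (x0 * x0 + x1 * x1 + x2 * x2 + (r0 * r0 + r1 * r1)).
Proof.
move=> v1; rewrite /update_bound /upwind.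
set q := (_ + _ + _ + _).
pose T := vpos v * (x1 - x0) + vneg v * (x2 - x1).
rewrite -/T.
set b := (X in X * y).
have vv : v * v <= 1 by move: v1; rewrite ler_norml => /andP[? ?]; nra.
have T2 : T ^+ 2 <= 2 * q.
  have s1 := sqr_ge0 (x1 + x0); have s2 := sqr_ge0 (x1 + x2).
  have t0 := sqr_ge0 x0; have t1 := sqr_ge0 x1; have t2 := sqr_ge0 x2.
  have t3 := sqr_ge0 r0; have t4 := sqr_ge0 r1.
  rewrite /T; case: (leP 0 v) => [v0|/ltW v0].
    rewrite vpos_ge0E// vneg_ge0E// mul0r addr0 exprMn.
    apply: (@le_trans _ _ ((x1 - x0) ^+ 2)).
      by rewrite ler_piMl ?sqr_ge0// expr2.
    by rewrite /q; lra.
  rewrite vpos_le0E// vneg_le0E// mul0r add0r exprMn.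
  apply: (@le_trans _ _ ((x2 - x1) ^+ 2)).
    by rewrite ler_piMl ?sqr_ge0// expr2.
  by rewrite /q; lra.
have r2 : ((r1 - r0) * v) ^+ 2 <= 2 * q.
  have s1 := sqr_ge0 (r0 + r1).
  have t0 := sqr_ge0 x0; have t1 := sqr_ge0 x1; have t2 := sqr_ge0 x2.
  rewrite exprMn mulrC.
  apply: (@le_trans _ _ ((r1 - r0) ^+ 2)).
    by rewrite ler_piMl ?sqr_ge0// expr2.
  by rewrite /q; lra.
have xq : x1 ^+ 2 <= q.
  have t0 := sqr_ge0 x0; have t2 := sqr_ge0 x2.
  have t3 := sqr_ge0 r0; have t4 := sqr_ge0 r1.
  by rewrite /q; lra.
have b2 : b ^+ 2 <= (3 * eps ^+ 4 + 6 * (dt * eps / dx) ^+ 2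
                     + 6 * (dt / dx) ^+ 2) * q.
  pose b1 := eps ^+ 2 * x1; pose b2 := dt * eps / dx * T.
  pose b3 := dt / dx * ((r1 - r0) * v).
  have -> : b = b1 - b2 - b3 by rewrite /b /b1 /b2 /b3; ring.
  have e1 : b1 ^+ 2 <= eps ^+ 4 * q.
    by rewrite /b1 exprMn -exprM ler_wpM2l// exprn_ge0// ltW.
  have e2 : b2 ^+ 2 <= (dt * eps / dx) ^+ 2 * (2 * q).
    by rewrite /b2 exprMn ler_wpM2l// sqr_ge0.
  have e3 : b3 ^+ 2 <= (dt / dx) ^+ 2 * (2 * q).
    by rewrite /b3 exprMn ler_wpM2l// sqr_ge0.
  have s1 := sqr_ge0 (b1 + b2); have s2 := sqr_ge0 (b1 + b3).
  have s3 := sqr_ge0 (b2 - b3).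
  apply: (@le_trans _ _ (3 * (b1 ^+ 2 + b2 ^+ 2 + b3 ^+ 2))); first lra.
  move: e1 e2 e3; move: (eps ^+ 4) ((_ / dx) ^+ 2) ((_ / dx) ^+ 2) => u1 u2 u3.
  lra.
apply: (@le_trans _ _ (eps ^+ 2 / 2 * (y * y) + b ^+ 2 / (2 * eps ^+ 2))).
  rewrite -subr_ge0 [X in 0 <= X](_ : _ =
    (2 * eps ^+ 2)^-1 * (eps ^+ 2 * y - b) ^+ 2); last first.
    by field; rewrite gt_eqF.
  by rewrite mulr_ge0 ?sqr_ge0// invr_ge0 mulr_ge0// sqr_ge0.
rewrite lerD2l [leRHS]mulrAC ler_pM2r// invr_gt0 mulr_gt0// exprn_gt0//.
Qed.

(** The term dt / (4 dx^2) is the cost of the coupling with the increment of rho, through [v D]^2 <=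
    [|v| D^2] / 2. Only a negative net rate needs the collisions, hence the minimum with 0. *)
Definition excess_rate : R :=
  Num.min (dissipation_rate - dt / (4 * dx ^+ 2)) 0.

(* The flux (r, J) |-> r J at the cell boundaries comes from
   r' (J - J0) + J (r1 - r) = (r' - r) (J - J0) + (r1 J - r J0), and the
   increment r' - r is absorbed by the implicit time discretization. *)
Lemma energy_balance (S r r' r1 J0 J G0' G G' A F0 F1 sA : R) :
  dt <= 1 / 3 * (S * dx ^+ 2 + 2 * eps * dx) -> 0 <= sA -> 0 <= S ->
  0 <= G0' -> 0 <= G' ->
  (r' - r) / dt + (J - J0) / dx = - sA * r' ->
  eps ^+ 2 / (2 * dt) * (G' - G) + dissipation_rate * A + (F1 - F0)
    <= - S * G' - (r1 - r) / dx * J ->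
  (J - J0) ^+ 2 <= 2^-1 * A -> A <= 2 * (G' + G0') ->
  r' ^+ 2 + eps ^+ 2 * G' <= r ^+ 2 + eps ^+ 2 * G +
    (- (2 * dt) * (F1 + r1 * J / dx - 2 * excess_rate * G') -
     - (2 * dt) * (F0 + r * J0 / dx - 2 * excess_rate * G0')).
Proof.
move=> CFL sA0 S0 G0'0 G'0 macro micro cs AG.
set m := excess_rate; set k := dissipation_rate in micro.
have A0 : 0 <= A by have := sqr_ge0 (J - J0); lra.
have mk : m <= k - dt / (4 * dx ^+ 2) by rewrite /m /excess_rate ge_min lexx.
have m0 : m <= 0 by rewrite /m /excess_rate ge_min lexx orbT.
(* This is where the CFL condition is used. Bounding [m * A] below by 2 m (G' + G0') costs 4 m G' up
   to a flux, and 4 m is 2 eps / dx - 3 dt / dx^2 unless the minimum is 0. *)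
have m4 : 0 <= 4 * m + S.
  rewrite /m /excess_rate /dissipation_rate minEle; case: ifP => _; last by lra.
  rewrite [X in 0 <= X](_ : _ =
    (S * dx ^+ 2 + 2 * eps * dx - 3 * dt) / dx ^+ 2).
    by apply: divr_ge0; [lra|exact: sqr_ge0].
  by field; rewrite gt_eqF.
have P1 : (r' - r) * r' / dt + (J - J0) * r' / dx <= 0.
  have -> : (r' - r) * r' / dt + (J - J0) * r' / dx = - (sA * r' ^+ 2).
    rewrite -[RHS]mulN1r mulrA mulN1r expr2 mulrA -macro.
    by ring.
  by rewrite oppr_le0 mulr_ge0 ?sqr_ge0.
have P2 : 0 <= (r' - r) ^+ 2 / (2 * dt) + (r' - r) * (J - J0) / dx
               + dt / (2 * dx ^+ 2) * (J - J0) ^+ 2.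
  rewrite [X in 0 <= X](_ : _ =
    (2 * dt)^-1 * (r' - r + dt * (J - J0) / dx) ^+ 2); last first.
    by field; rewrite !gt_eqF.
  by rewrite mulr_ge0 ?sqr_ge0// invr_ge0 mulr_ge0// ltW.
have P3 : dt / (2 * dx ^+ 2) * (J - J0) ^+ 2 <= dt / (4 * dx ^+ 2) * A.
  have -> : dt / (4 * dx ^+ 2) * A = dt / (2 * dx ^+ 2) * (2^-1 * A).
    by field; rewrite gt_eqF.
  by rewrite ler_wpM2l// divr_ge0 ?ltW// mulr_gt0// exprn_gt0.
have P4 : m * A <= (k - dt / (4 * dx ^+ 2)) * A by rewrite ler_wpM2r.
have P5 : m * (2 * (G' + G0')) <= m * A by rewrite ler_wnM2l.
have P6 : 0 <= (4 * m + S) * G' by rewrite mulr_ge0.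
(* The two terms in r' - r come from r'^2 - r^2 = 2 (r' - r) r' - (r' - r)^2. *)
rewrite -subr_ge0 [X in 0 <= X](_ : _ = 2 * dt *
  - (((r' - r) * r' / dt - (r' - r) ^+ 2 / (2 * dt)) +
     eps ^+ 2 / (2 * dt) * (G' - G) + (F1 - F0) + (r1 * J / dx - r * J0 / dx)
     - 2 * m * (G' - G0'))); last first.
  by field; rewrite !gt_eqF.
rewrite mulr_ge0 ?mulr_ge0 ?(ltW dt_gt0)// oppr_ge0.
move: P1 P2 P3 P4 micro.
move: (dt / (4 * dx ^+ 2)) (dt / (2 * dx ^+ 2) * _) (_ / (2 * dt) * _).
move=> u1 u2 u3.
move: ((r' - r) * r' / dt) ((r' - r) ^+ 2 / (2 * dt)) => u4 u5.
move: (dx^-1) => ix.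
lra.
Qed.

End pointwise_estimates.

(** * One step of the scheme *)

Ltac prove_vintegrable :=
  repeat first
    [ assumption
    | exact: L2_vintegrable
    | exact: L2_vintegrableM
    | exact: vintegrable_cst
    | exact: vintegrable_velocity
    | apply: vintegrable_vposM
    | apply: vintegrable_vnegM
    | apply: vintegrable_speedM
    | apply: vintegrable_velocityM
    | apply: vintegrableZ
    | apply: vintegrableB
    | apply: vintegrableD ].

Section one_step.
Context {R : realType} (s : R -> R -> R) (s_m s_M : R).
Local Notation mu := (@lebesgue_measure R).
Local Notation V := (`[(-1 : R), 1]).
Hypothesis s_meas : measurable_fun ([set` V] `*` [set` V])
  (fun p : measurableTypeR R * measurableTypeR R => s p.1 p.2).
Hypothesis s_m_gt0 : 0 < s_m.
Hypothesis s_bounds :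
  forall v w, v \in V -> w \in V -> s_m <= s v w <= s_M.
Hypothesis s_int :
  forall v, v \in V -> \int[mu]_(w in [set` V]) s v w = 1.
Hypothesis s_sym : forall v w, v \in V -> w \in V -> s v w = s w v.
Context (sigma sigmaA : R -> R) (sigma_m eps dx dt : R).
Hypothesis sigma_m_gt0 : 0 < sigma_m.
Hypothesis sigma_ge : forall x, sigma_m <= sigma x.
Hypothesis sigmaA_ge0 : forall x, 0 <= sigmaA x.
Hypotheses (eps_gt0 : 0 < eps) (dx_gt0 : 0 < dx) (dt_gt0 : 0 < dt).
Context (rho rho' : int -> R) (g g' : int -> R -> R).
Hypothesis g_L2 : forall i, L2_velocity (g i).
Hypothesis g'_L2 : forall i, L2_velocity (g' i).
Hypothesis macro : macro_scheme dx dt sigmaA rho rho' g'.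
Hypothesis micro : micro_scheme eps dx dt s sigma rho g g'.
Hypothesis g_avg : forall i, vavg (g i) = 0.

Let G i := vavg (fun v => g i v * g i v).
Let G' i := vavg (fun v => g' i v * g' i v).
Let J i := vavg (fun v => v * g' i v).
Let D i v := g' i v - g' (i - 1) v.
Let A i := vavg (fun v => `|v| * (D i v * D i v)).
Let U i v := upwind v (g (i - 1) v) (g i v) (g (i + 1) v).
Let psi i v :=
  transport_flux eps dx dt v (g (i - 1) v) (g i v) (g' (i - 1) v) (g' i v).
Let Lc i := collision s (g' i).
Let drho i := (rho (i + 1) - rho i) / dx.

(** * Integrability of the terms, and the averaged micro equation *)

Let U_int i : vintegrable (U i).
Proof.
have ? := g_L2 i; have ? := g_L2 (i - 1); have ? := g_L2 (i + 1).
by rewrite /U /upwind; prove_vintegrable.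
Qed.

Let DD_int i : vintegrable (fun v => D i v * D i v).
Proof.
have ? := g'_L2 i; have ? := g'_L2 (i - 1).
apply: (@eq_vintegrable _ (fun v =>
   g' i v * g' i v - 2 * (g' i v * g' (i - 1) v) + g' (i - 1) v * g' (i - 1) v)).
  by move=> v _; rewrite /D; ring.
by prove_vintegrable.
Qed.

Let psi_int i : vintegrable (psi i).
Proof.
have ? := g_L2 i; have ? := g_L2 (i - 1).
have ? := g'_L2 i; have ? := g'_L2 (i - 1).
by rewrite /psi /transport_flux; prove_vintegrable.
Qed.

Let L_int i : vintegrable (Lc i).
Proof.
exact: (vintegrable_collision s_meas s_m_gt0 s_bounds s_int
  (L2_vintegrable (g'_L2 i))).
Qed.

Let gL_int i : vintegrable (fun v => g' i v * Lc i v).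
Proof.
exact: (vintegrableM_collision s_meas s_m_gt0 s_bounds s_int (g'_L2 i)).
Qed.

Let micro_update i : {ae mu, forall v, v \in V ->
  eps ^+ 2 * (g' i v - g i v) =
    - (dt * eps / dx) * (U i v - vavg (U i))
    + dt * sigma (midpoint dx i) * Lc i v - dt * drho i * v}.
Proof.
apply: ae_lebesgueS (micro i) => v h /h {h}.
rewrite /minus_vavg -/(U i) -/(U i v) -/(Lc i) -/(drho i).
set u := U i v - _; set l := Lc i v; move=> e.
have -> : eps ^+ 2 * (g' i v - g i v) = eps ^+ 2 * dt * ((g' i v - g i v) / dt).
  by field; rewrite gt_eqF.
rewrite (_ : (g' i v - g i v) / dt = sigma (midpoint dx i) / eps ^+ 2 * l -
  1 / eps ^+ 2 * (v * drho i) - 1 / (eps * dx) * u); last by rewrite -e; ring.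
by field; rewrite !gt_eqF.
Qed.

(** Every term driving the update has zero average: the transport is projected, collisions conserve
    mass, and v is odd. *)
Lemma vavg_micro_step i : vavg (g' i) = 0.
Proof.
have ? := g_L2 i; have ? := g'_L2 i; have := U_int i; have := L_int i.
have L0 : vavg (Lc i) = 0.
  apply: (vavg_collision s_meas s_m_gt0 s_bounds s_int s_sym).
  exact: L2_vintegrable.
have := ae_eq_vavg _ _ (micro_update i); move: L0.
move: (U i) (Lc i) => u l l0 upd li ui.
move: upd; rewrite !vavgB ?vavgD ?vavgZ ?vavgB ?vavg_cst;
  try by prove_vintegrable.
rewrite g_avg vavg_velocity l0 subrr !mulr0 subr0 addr0 subr0.
move=> /(_ ltac:(prove_vintegrable) ltac:(prove_vintegrable)) /eqP.
by rewrite mulf_eq0 expf_eq0/= gt_eqF//= => /eqP.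
Qed.

(** Coercivity applies because the new g has zero average; as its bound is nonpositive, sigma may be
    replaced by [sigma_m]. *)
Let collision_le0 i : sigma (midpoint dx i) * vavg (fun v => g' i v * Lc i v)
  <= - (2 * s_m * sigma_m) * G' i.
Proof.
have G'0 : 0 <= G' i by apply: vavg_ge0 => v; exact: sqr_ge0.
have := collision_coercive s_meas s_m_gt0 s_bounds s_int s_sym (g'_L2 i)
  (vavg_micro_step i).
rewrite -/(G' i) -/(Lc i) => h.
apply: (@le_trans _ _ (sigma (midpoint dx i) * (- (2 * s_m) * G' i))).
  by rewrite ler_wpM2l// (le_trans (ltW sigma_m_gt0)).
rewrite -subr_ge0 [X in 0 <= X](_ : _ =
  (sigma (midpoint dx i) - sigma_m) * (2 * s_m * G' i)); last by ring.
by rewrite mulr_ge0 ?subr_ge0// mulr_ge0// mulr_ge0// ltW.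
Qed.

(** This averages [upwind_pointwise] over v, after its right-hand side has been rewritten by the
    micro equation multiplied by the new g. *)
Let micro_energy i :
  eps ^+ 2 / (2 * dt) * (G' i - G i) + dissipation_rate eps dx dt * A i
  + (vavg (psi (i + 1)) - vavg (psi i))
  <= - (2 * s_m * sigma_m) * G' i - drho i * J i.
Proof.
have ? := g_L2 i; have ? := g'_L2 i; have ? := DD_int i.
have ? := gL_int i; have ? := psi_int i; have ? := psi_int (i + 1).
pose c1 := eps ^+ 2 / (2 * dt); pose c2 := dissipation_rate eps dx dt.
pose sg := sigma (midpoint dx i); pose c3 := eps / dx * vavg (U i).
pose lhs v := c1 * (g' i v * g' i v - g i v * g i v) +
  c2 * (`|v| * (D i v * D i v)) + (psi (i + 1) v - psi i v).
pose rhs v := sg * (g' i v * Lc i v) - drho i * (v * g' i v) + c3 * g' i v.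
have lhs_int : vintegrable lhs by rewrite /lhs; prove_vintegrable.
have rhs_int : vintegrable rhs by rewrite /rhs; prove_vintegrable.
have le_lr : vavg lhs <= vavg rhs.
  apply: ae_le_vavg => //; apply: ae_lebesgueS (micro_update i) => v h Vv.
  have := upwind_pointwise eps dx_gt0 dt_gt0 (g (i - 1) v) (g i v)
    (g (i + 1) v) (g' (i - 1) v) (g' i v) (g' (i + 1) v) (velocity_le1 Vv).
  rewrite -/(U i v) -/(D i v) -/(psi i v) -/c1 -/c2.
  rewrite (_ : transport_flux _ _ _ _ _ _ _ _ = psi (i + 1) v); last first.
    by rewrite /psi addrK.
  rewrite -/(lhs v) => /le_trans; apply.
  rewrite le_eqVlt; apply/orP; left; apply/eqP.
  rewrite (_ : eps ^+ 2 / dt * _ =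
    g' i v / dt * (eps ^+ 2 * (g' i v - g i v))); last by ring.
  rewrite h// /rhs /c3 -/sg; field; rewrite !gt_eqF//.
have lhsE p p1 : vintegrable p -> vintegrable p1 ->
    vavg (fun v => c1 * (g' i v * g' i v - g i v * g i v) +
      c2 * (`|v| * (D i v * D i v)) + (p1 v - p v)) =
    c1 * (G' i - G i) + c2 * A i + (vavg p1 - vavg p).
  move=> ? ?; rewrite vavgD ?[vavg (fun v => p1 v - p v)]vavgB
    ?vavgD ?vavgZ ?vavgZ; try by prove_vintegrable.
  by rewrite vavgB//; prove_vintegrable.
have rhsE : vavg rhs = sg * vavg (fun v => g' i v * Lc i v) - drho i * J i.
  rewrite vavgD ?vavgB ?vavgZ ?vavgZ ?vavgZ; try by prove_vintegrable.
  (* The term in [c3] stems from the projection I - [.]; it is a constant times the average of the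
     new g, which is 0. *)
  by rewrite vavg_micro_step mulr0 addr0.
move: le_lr; rewrite rhsE /lhs lhsE// => /le_trans; apply.
by rewrite lerD2r; exact: collision_le0.
Qed.

Let macro_step i : (rho' i - rho i) / dt + (J i - J (i - 1)) / dx
  = - sigmaA (node dx i) * rho' i.
Proof.
have ? := g'_L2 i; have ? := g'_L2 (i - 1).
rewrite -macro /J -vavgB; try by prove_vintegrable.
rewrite [X in _ + X = _]mulrC -vavgZ; last by prove_vintegrable.
by congr (_ + _); apply: eq_vavg => v _; ring.
Qed.

(** * Bounds on the averaged fluxes and on the densities at the new time *)

Let G_ge0 i : 0 <= G i. Proof. by apply: vavg_ge0 => v; exact: sqr_ge0. Qed.

Let G'_ge0 i : 0 <= G' i. Proof. by apply: vavg_ge0 => v; exact: sqr_ge0. Qed.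

Let sqr_J_sub i : (J i - J (i - 1)) ^+ 2 <= 2^-1 * A i.
Proof.
have ? := g'_L2 i; have ? := g'_L2 (i - 1).
rewrite /J -vavgB; try by prove_vintegrable.
rewrite (eq_vavg (h := fun v => v * D i v)) => [|v _]; last by rewrite /D; ring.
apply: sqr_vavg_velocity => //.
by rewrite /D; prove_vintegrable.
Qed.

Let A_le i : A i <= 2 * (G' i + G' (i - 1)).
Proof.
have ? := g'_L2 i; have ? := g'_L2 (i - 1); have ? := DD_int i.
rewrite -vavgD; try by prove_vintegrable.
rewrite -vavgZ; last by prove_vintegrable.
apply: le_vavg; try by prove_vintegrable.
move=> v /velocity_le1 v1; apply: (@le_trans _ _ (D i v * D i v)).
  by rewrite ler_piMl// sqr_ge0.
by have := sqr_ge0 (g' i v + g' (i - 1) v); rewrite /D; lra.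
Qed.

Let sqr_J_le i : J i ^+ 2 <= G' i.
Proof.
have ? := g'_L2 i.
apply: le_trans (sqr_vavg_velocity _ _) _; try by prove_vintegrable.
apply: (@le_trans _ _ (1 * vavg (fun v => `|v| * (g' i v * g' i v)))).
  rewrite ler_wpM2r//; last by lra.
  by apply: vavg_ge0 => v; rewrite mulr_ge0// sqr_ge0.
rewrite mul1r; apply: le_vavg; try by prove_vintegrable.
by move=> v /velocity_le1 v1; rewrite ler_piMl// sqr_ge0.
Qed.

Let norm_vavg_psi i : `|vavg (psi i)| <=
  flux_bound eps dx dt * (G (i - 1) + G i + G' (i - 1) + G' i).
Proof.
have ? := g_L2 i; have ? := g_L2 (i - 1).
have ? := g'_L2 i; have ? := g'_L2 (i - 1); have ? := psi_int i.
set C := flux_bound eps dx dt.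
pose q v := C * (g (i - 1) v * g (i - 1) v + g i v * g i v +
  g' (i - 1) v * g' (i - 1) v + g' i v * g' i v).
have q_int : vintegrable q by rewrite /q; prove_vintegrable.
have <- : vavg q = C * (G (i - 1) + G i + G' (i - 1) + G' i).
  by rewrite vavgZ ?vavgD; try by prove_vintegrable.
have psi_le v : v \in V -> `|psi i v| <= q v.
  move=> /velocity_le1.
  exact: (norm_transport_flux eps_gt0 dx_gt0 dt_gt0).
rewrite ler_norml -[- vavg q]mulN1r -vavgZ//; apply/andP; split.
  apply: le_vavg => //; first exact: vintegrableZ.
  by move=> v /psi_le; rewrite ler_norml mulN1r => /andP[].
by apply: le_vavg => // v /psi_le; rewrite ler_norml => /andP[].
Qed.

(** Testing the update with the new g, the collision term is nonpositive and is dropped, and the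
    projected average meets a zero average. What is left bounds the new density by neighbouring
    densities at the old time. *)
Let micro_bound i : eps ^+ 2 / 2 * G' i <=
  update_bound eps dx dt / (2 * eps ^+ 2) *
  (G (i - 1) + G i + G (i + 1) + (rho i * rho i + rho (i + 1) * rho (i + 1))).
Proof.
have ? := g_L2 i; have ? := g_L2 (i - 1); have ? := g_L2 (i + 1).
have ? := g'_L2 i; have ? := gL_int i.
set C := update_bound eps dx dt / (2 * eps ^+ 2).
pose sg := dt * sigma (midpoint dx i); pose c := dt * eps / dx * vavg (U i).
pose r := rho i * rho i + rho (i + 1) * rho (i + 1).
pose q v := g (i - 1) v * g (i - 1) v + g i v * g i v +
  g (i + 1) v * g (i + 1) v + r.
pose rhs v := C * q v + c * g' i v + sg * (g' i v * Lc i v).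
have q_int : vintegrable q by rewrite /q; prove_vintegrable.
have rhs_int : vintegrable rhs by rewrite /rhs; prove_vintegrable.
have : vavg (fun v => eps ^+ 2 / 2 * (g' i v * g' i v)) <= vavg rhs.
  apply: ae_le_vavg => //; first by prove_vintegrable.
  apply: ae_lebesgueS (micro_update i) => v h Vv.
  have := update_pointwise dx dt eps_gt0 (g (i - 1) v) (g i v) (g (i + 1) v)
    (g' i v) (rho i) (rho (i + 1)) (velocity_le1 Vv).
  rewrite -/(U i v) -/(drho i) -/r -/(q v) -/C.
  have : eps ^+ 2 * g' i v * g' i v =
    eps ^+ 2 * g i v * g' i v + (eps ^+ 2 * (g' i v - g i v)) * g' i v by ring.
  rewrite h// /rhs /c /sg; lra.
rewrite /rhs vavgD ?vavgD ?vavgZ; try by prove_vintegrable.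
rewrite vavg_micro_step mulr0 addr0 -/(G' i).
have -> : vavg q = G (i - 1) + G i + G (i + 1) + r.
  by rewrite /q !vavgD ?vavg_cst//; prove_vintegrable.
move=> /le_trans; apply; rewrite gerDl /sg -mulrA.
rewrite mulr_ge0_le0 ?(ltW dt_gt0)// (le_trans (collision_le0 i))//.
by rewrite mulNr oppr_le0 mulr_ge0// mulr_ge0 ?mulr_ge0 ?ltW.
Qed.

(** Implicit absorption multiplies the new rho by 1 + dt sigma_A >= 1, so rho' is controlled by the
    explicit right-hand side. *)
Let macro_bound i : rho' i ^+ 2 <=
  2 * rho i ^+ 2 + 2 * (dt / dx) ^+ 2 * (G' i + G' (i - 1)).
Proof.
set sA := sigmaA (node dx i); have sA0 : 0 <= sA := sigmaA_ge0 _.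
have e : (1 + dt * sA) * rho' i = rho i - dt / dx * (J i - J (i - 1)).
  have : dt * ((rho' i - rho i) / dt + (J i - J (i - 1)) / dx) =
    dt * (- sA * rho' i) by rewrite macro_step.
  have -> : dt * ((rho' i - rho i) / dt + (J i - J (i - 1)) / dx) =
    rho' i - rho i + dt / dx * (J i - J (i - 1)).
    by field; rewrite !gt_eqF.
  lra.
apply: (@le_trans _ _ (((1 + dt * sA) * rho' i) ^+ 2)).
  rewrite exprMn ler_peMl ?sqr_ge0// exprn_ege1//.
  by rewrite lerDl mulr_ge0// ltW.
rewrite e; set b := dt / dx * _.
have b2 : b ^+ 2 <= (dt / dx) ^+ 2 * (G' i + G' (i - 1)).
  rewrite /b exprMn ler_wpM2l ?sqr_ge0// (le_trans (sqr_J_sub i))//.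
  by have := A_le i; lra.
rewrite -(mulrA 2 ((dt / dx) ^+ 2)).
by have := sqr_ge0 (rho i + b); move: (_ ^+ 2 * _) b2 => w; lra.
Qed.

(** * Local energy balance and its summation over the grid *)

Let e i := rho i ^+ 2 + eps ^+ 2 * G i.
Let e' i := rho' i ^+ 2 + eps ^+ 2 * G' i.

Hypothesis CFL : dt <= 1 / 3 * (2 * s_m * sigma_m * dx ^+ 2 + 2 * eps * dx).

(** Three fluxes add up: transport, the coupling of rho with [v g], and the transfer of the
    densities G' between neighbours caused by splitting D^2. *)
Let F i := - (2 * dt) * (vavg (psi i) + rho i * J (i - 1) / dx
  - 2 * excess_rate eps dx dt * G' (i - 1)).

Let local_energy_balance i : e' i <= e i + (F (i + 1) - F i).
Proof.
have S0 : 0 <= 2 * s_m * sigma_m by rewrite mulr_ge0 ?mulr_ge0 ?ltW.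
rewrite /F addrK.
exact: (energy_balance dx_gt0 dt_gt0 CFL (sigmaA_ge0 _) S0 (G'_ge0 _)
  (G'_ge0 i) (macro_step i) (micro_energy i) (sqr_J_sub i) (A_le i)).
Qed.

Let N i := rho i ^+ 2 + G i + G' i.
Let N_ge0 i : 0 <= N i.
Proof. by rewrite /N !addr_ge0 ?sqr_ge0. Qed.

Let C := 2 * dt * (flux_bound eps dx dt + dx^-1 + 2 * `|excess_rate eps dx dt|).

Let norm_F i : `|F i| <= C * (N i + N (i - 1)).
Proof.
have := N_ge0 i; have := N_ge0 (i - 1); have := norm_vavg_psi i.
pose m := excess_rate eps dx dt; set fb := flux_bound eps dx dt => np N1 N0.
have fb0 : 0 <= fb by apply/ltW/flux_bound_gt0.
have b1 : `|vavg (psi i)| <= fb * (N i + N (i - 1)).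
  apply: le_trans np _; apply: ler_wpM2l => //.
  by have := sqr_ge0 (rho i); have := sqr_ge0 (rho (i - 1)); rewrite /N; lra.
have b2 : `|rho i * J (i - 1) / dx| <= dx^-1 * (N i + N (i - 1)).
  rewrite mulrC normrM ger0_norm ?invr_ge0 ?(ltW dx_gt0)// ler_pM2l ?invr_gt0//.
  have := sqr_ge0 (rho i + J (i - 1)); have := sqr_ge0 (rho i - J (i - 1)).
  have := sqr_J_le (i - 1); have := G_ge0 i; have := G_ge0 (i - 1).
  have := G'_ge0 i; have := G'_ge0 (i - 1).
  have := sqr_ge0 (rho i); have := sqr_ge0 (rho (i - 1)).
  by rewrite ler_norml /N => *; apply/andP; split; lra.
have b3 : `|2 * m * G' (i - 1)| <= 2 * `|m| * (N i + N (i - 1)).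
  rewrite (normrM (2 * m)) (normrM 2 m) (ger0_norm (G'_ge0 _)) ger0_norm//.
  apply: ler_wpM2l; first by rewrite mulr_ge0.
  have := G_ge0 i; have := G_ge0 (i - 1); have := G'_ge0 i.
  by have := sqr_ge0 (rho i); have := sqr_ge0 (rho (i - 1)); rewrite /N; lra.
have dt2 : 0 < 2 * dt by rewrite mulr_gt0.
rewrite /F /C -/m -/fb normrM normrN (gtr0_norm dt2) -[leRHS]mulrA ler_pM2l//.
apply: le_trans (ler_normB _ _) _; apply: le_trans (lerD (ler_normD _ _) b3) _.
by rewrite (mulrDl (fb + dx^-1)) lerD2r (mulrDl fb); exact: lerD.
Qed.

(** Finite energy makes the densities rho^2 and G summable, [micro_bound] carries this over to G',
    and [N] then dominates the flux, so the local balance telescopes. *)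
Lemma energy_step : fin_esum e ->
  (\esum_(i in [set: int]) (e' i)%:E <= \esum_(i in [set: int]) (e i)%:E)%E.
Proof.
move=> fe; have e2 : 0 < eps ^+ 2 by rewrite exprn_gt0.
have r_ge0 i : 0 <= rho i ^+ 2 := sqr_ge0 _.
have fr : fin_esum (fun i => rho i ^+ 2).
  by apply: fin_esum_le fe => i; rewrite lerDl mulr_ge0// ltW.
have fG : fin_esum G.
  have e_ge0 i : 0 <= e i by rewrite addr_ge0// mulr_ge0// ltW.
  have ie : 0 < (eps ^+ 2)^-1 by rewrite invr_gt0.
  apply: fin_esum_le (fin_esumZ ie e_ge0 fe) => i.
  by rewrite mulrDr mulKf ?gt_eqF// lerDr mulr_ge0// ltW.
have fG' : fin_esum G'.
  pose q i := G (i - 1) + G i + G (i + 1)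
    + (rho i ^+ 2 + rho (i + 1) ^+ 2).
  have q_ge0 i : 0 <= q i by rewrite !addr_ge0.
  have fq : fin_esum q.
    have fGm : fin_esum (fun i => G (i - 1)) := fin_esum_shift (- 1) fG.
    have fGp : fin_esum (fun i => G (i + 1)) := fin_esum_shift 1 fG.
    have frp : fin_esum (fun i => rho (i + 1) ^+ 2) := fin_esum_shift 1 fr.
    by do ![apply: fin_esumD => //; try by move=> i; rewrite !addr_ge0].
  pose c := (eps ^+ 2 / 2)^-1 * (update_bound eps dx dt / (2 * eps ^+ 2)).
  have e22 : 0 < eps ^+ 2 / 2 by rewrite divr_gt0.
  have c_gt0 : 0 < c.
    by rewrite mulr_gt0 ?invr_gt0// divr_gt0 ?mulr_gt0// update_bound_gt0.
  apply: fin_esum_le (fin_esumZ c_gt0 q_ge0 fq) => i.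
  rewrite /c -mulrA ler_pdivlMl//; exact: micro_bound.
have fr' : fin_esum (fun i => rho' i ^+ 2).
  have dd : 0 < 2 * (dt / dx) ^+ 2 by rewrite mulr_gt0// exprn_gt0// divr_gt0.
  have fG'm : fin_esum (fun i => G' (i - 1)) := fin_esum_shift (- 1) fG'.
  apply: fin_esum_le macro_bound _; apply: fin_esumD => //.
  - by move=> i; rewrite mulr_ge0.
  - by move=> i; rewrite mulr_ge0 ?addr_ge0// ltW.
  - by apply: fin_esumZ.
  - by apply: fin_esumZ => // [i|]; [rewrite addr_ge0|exact: fin_esumD].
have fN : fin_esum N.
  by do ![apply: fin_esumD => //; try by move=> i; rewrite !addr_ge0].
have fNm : fin_esum (fun i => N (i - 1)) := fin_esum_shift (- 1) fN.
have C_gt0 : 0 < C.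
  rewrite /C mulr_gt0 ?mulr_gt0//.
  have h1 : 0 < flux_bound eps dx dt by exact: flux_bound_gt0.
  have h2 : 0 < dx^-1 by rewrite invr_gt0.
  have h3 : 0 <= 2 * `|excess_rate eps dx dt| by rewrite mulr_ge0.
  lra.
apply: (esum_le_telescope _ _ norm_F _ local_energy_balance).
- by move=> i; rewrite addr_ge0// mulr_ge0// ltW.
- by move=> i; rewrite addr_ge0 ?sqr_ge0// mulr_ge0// ltW.
- by apply: fin_esumZ => // [i|]; [rewrite addr_ge0|exact: fin_esumD].
Qed.

End one_step.

(** * From one step to all times *)

Lemma energyE (R : realType) (eps dx : R) (rho : int -> R) (g : int -> R -> R) :
  0 < eps -> 0 < dx ->
  energy eps dx rho g = (dx%:E * \esum_(i in [set: int])
    (rho i ^+ 2 + eps ^+ 2 * vavg (fun v => g i v * g i v))%:E)%E.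
Proof.
move=> eps0 dx0; have e2 : 0 < eps ^+ 2 by rewrite exprn_gt0.
have g0 i : 0 <= vavg (fun v => g i v * g i v).
  by apply: vavg_ge0 => v; exact: sqr_ge0.
rewrite /energy -esumZl// -esumZl// -esumD.
- apply: eq_esum => i _; rewrite -EFinD; congr (_%:E).
  rewrite (_ : (fun v => g i v ^+ 2) = (fun v => g i v * g i v)); last first.
    by apply/funext => v; rewrite expr2.
  by ring.
- by move=> i _; rewrite lee_fin mulr_ge0 ?sqr_ge0// ltW.
- move=> i _; rewrite lee_fin mulr_ge0 ?(ltW e2)// mulr_ge0 ?(ltW dx0)//.
  by apply: vavg_ge0 => v; exact: sqr_ge0.
Qed.

Theorem theorem3p1 (R : realType)
  (s : R -> R -> R) (s_m s_M : R)
  (s_meas : measurable_fun (`[(-1 : R), 1] `*` `[(-1 : R), 1])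
              (fun p : measurableTypeR R * measurableTypeR R => s p.1 p.2))
  (s_m_gt0 : 0 < s_m)
  (s_bounds : forall v w : R, v \in `[(-1 : R), 1] -> w \in `[(-1 : R), 1] ->
     s_m <= s v w <= s_M)
  (s_int : forall v : R, v \in `[(-1 : R), 1] ->
     \int[@lebesgue_measure R]_(w in `[(-1 : R), 1]) s v w = 1)
  (s_sym : forall v w : R, v \in `[(-1 : R), 1] -> w \in `[(-1 : R), 1] ->
     s v w = s w v)
  (sigma sigmaA : R -> R) (sigma_m sigma_M sigma_AM : R)
  (sigma_m_gt0 : 0 < sigma_m)
  (sigma_bounds : forall x : R, sigma_m <= sigma x <= sigma_M)
  (sigmaA_bounds : forall x : R, 0 <= sigmaA x <= sigma_AM)
  (eps dx dt : R) (eps_gt0 : 0 < eps) (dx_gt0 : 0 < dx) (dt_gt0 : 0 < dt)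
  (rho : nat -> int -> R) (g : nat -> int -> R -> R)
  (g_L2 : forall (n : nat) (i : int), L2_velocity (g n i))
  (macro : forall n : nat,
     macro_scheme dx dt sigmaA (rho n) (rho n.+1) (g n.+1))
  (micro : forall n : nat,
     micro_scheme eps dx dt s sigma (rho n) (g n) (g n.+1))
  (finite_energy0 : (energy eps dx (rho 0%N) (g 0%N) < +oo)%E)
  (g0_avg : forall i : int, vavg (g 0%N i) = 0)
  (CFL : dt <= 1 / 3 * (2 * s_m * sigma_m * dx ^+ 2 + 2 * eps * dx)) :
  forall n : nat,
    (energy eps dx (rho n) (g n) <= energy eps dx (rho 0%N) (g 0%N))%E.
Proof.
have sigma_ge x : sigma_m <= sigma x by have /andP[] := sigma_bounds x.
have sigmaA_ge0 x : 0 <= sigmaA x by have /andP[] := sigmaA_bounds x.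
have step n : (forall i, vavg (g n i) = 0) ->
    (energy eps dx (rho n) (g n) < +oo)%E ->
    (energy eps dx (rho n.+1) (g n.+1) <= energy eps dx (rho n) (g n))%E.
  move=> avg0; rewrite !energyE// => fin_en; rewrite lee_pmul2l ?lte_fin//.
  apply: (energy_step s_meas s_m_gt0 s_bounds s_int s_sym sigma_m_gt0 sigma_ge
    sigmaA_ge0 eps_gt0 dx_gt0 dt_gt0 (g_L2 n) (g_L2 n.+1) (macro n) (micro n)
    avg0 CFL).
  move: fin_en; rewrite /fin_esum; case: esum => [r||]; rewrite ?ltry//.
  by rewrite gt0_muley.
(* The induction carries the zero average along with the estimate; the estimate at time n also
   supplies the finite energy that the next step requires. *)
move=> n; suff [] : (forall i, vavg (g n i) = 0) /\
  (energy eps dx (rho n) (g n) <= energy eps dx (rho 0%N) (g 0%N))%E by [].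
elim: n => [|n [avg0 en]]; first by split.
split; last exact: le_trans (step n avg0 (le_lt_trans en finite_energy0)) en.
move=> i; exact: (vavg_micro_step s_meas s_m_gt0 s_bounds s_int s_sym
  eps_gt0 dx_gt0 dt_gt0 (g_L2 n) (g_L2 n.+1) (micro n) avg0).
Qed.
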